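(* Let $d\ge2$ be an integer and let job sizes be exponential with mean one. For the memory dependent SQ($d$) policy with Idle Server Messaging (ISM) and memory size $A$, the mean response time satisfies $$\lim_{\lambda\to1^-}-\frac{\mathbb{E}[R_\lambda^{(SQ)}]}{\log(1-\lambda)}=\frac1{A+1}\cdot\frac1{\log(d)},$$ while for the LL($d$) variant (ISM with memory size $A$) $$\lim_{\lambda\to1^-}-\frac{\mathbb{E}[R_\lambda^{(LL)}]}{\log(1-\lambda)}=\frac1{A+1}\cdot\frac1{d-1}.$$
   Context: Response times are those of the queue at the cavity (large-system approximation) in equilibrium, with arrival rate $\lambda\in(0,1)$ per server. $A\ge1$ is an integer. $\pi_0=\pi_0(\lambda)\in(0,1]$ is the equilibrium probability that the memory is empty. SQ($d$) with memory: an arriving job is sent to an idle server with probability $1-\pi_0$ (idle server id in memory), and with probability $\pi_0$ it joins the shortest among $d$ independent equilibrium queues. The equilibrium probabilities $u_k$ that a queue has at least $k$ jobs satisfy $u_0=1$, $u_1=\lambda$ and $u_{k+1}=\lambda\pi_0u_k^d$ for $k\ge1$. Service is first-come-first-served, the number of jobs ahead of an arriving job is at least $k\ge1$ with probability $\pi_0u_k^d$, and $\mathbb{E}[R_\lambda^{(SQ)}]=1+\pi_0\sum_{k\ge1}u_k^d$. LL($d$) with memory: an arriving job is sent to an idle server with probability $1-\pi_0$, and with probability $\pi_0$ it joins the queue with the least workload among $d$ independent equilibrium queues. The equilibrium complementary cdf $\bar F(w)$ of the workload satisfies $\bar F(0)=\lambda$ and $\bar F'(w)=\lambda\pi_0\bar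 F(w)^d-\bar F(w)$ for $w\ge0$. The waiting time exceeds $w\ge0$ with probability $\pi_0\bar F(w)^d$, so $\mathbb{E}[R_\lambda^{(LL)}]=1+\pi_0\int_0^\infty\bar F(w)^d\,dw$. ISM memory scheme: a server notifies the dispatcher whenever it becomes idle, and the dispatcher stores its id if fewer than $A$ ids are in memory; each job arrival uses (and removes) one id if the memory is nonempty. The number of ids in memory is a birth-death process on $\{0,1,\dots,A\}$ with birth rate $\kappa$ and death rate $\lambda$ (per server), where $\kappa$ is the equilibrium rate at which a server becomes idle: $\kappa=u_1-u_2$ for SQ($d$) and $\kappa=-\bar F'(0)$ for LL($d$). $\pi_0$ is the stationary probability of state $0$ of this process, determined self-consistently (since $\kappa$ depends on $\pi_0$), i.e. $\pi_0=\big(\sum_{i=0}^A(\kappa/\lambda)^i\big)^{-1}$. *)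

(* Defs.v *)
From Stdlib Require Import Reals Lra Lia.
From Coquelicot Require Import Coquelicot.
Open Scope R_scope.

(** Below, [lam] is the arrival rate per server
    and [pi0] the probability that the memory is empty. *)

(** Global balance for the birth-death chain on the states [0..A], with birth
    rate [kappa] below state [A] and death rate [lam] above state [0].  Only
    the values [p 0 .. p A] matter. *)
Definition birth_death_stationary (A : nat) (kappa lam : R) (p : nat -> R) : Prop :=
  (forall i, (i <= A)%nat -> 0 <= p i) /\
  sum_f_R0 p A = 1 /\
  forall i, (i <= A)%nat ->
    ((if (i <? A)%nat then kappa else 0) + (if (0 <? i)%nat then lam else 0)) * p i
    = (if (0 <? i)%nat then kappa * p (i - 1)%nat else 0)
      + (if (i <? A)%nat then lam * p (i + 1)%nat else 0).

Definition ISM_memory (A : nat) (lam kappa pi0 : R) : Prop :=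
  exists p, birth_death_stationary A kappa lam p /\ pi0 = p 0%nat.

(** [u k] is the probability that a natural-number-valued variable is at least [k]. *)
Definition is_queue_tail (u : nat -> R) : Prop :=
  u 0%nat = 1 /\
  (forall k, 0 <= u (S k) <= u k) /\
  is_lim_seq u 0.

(** [F w] is the probability that a nonnegative variable exceeds [w]; the
    values of [F] at negative arguments are irrelevant. *)
Definition is_workload_ccdf (F : R -> R) : Prop :=
  (forall w, 0 <= w -> 0 <= F w <= 1) /\
  (forall v w, 0 <= v <= w -> F w <= F v) /\
  (forall w, 0 <= w -> filterlim F (at_right w) (locally (F w))) /\
  is_lim F p_infty 0.

(** Derivative relative to [[0, +oo)]: two-sided for [w > 0], right-sided at [0]. *)
Definition is_derive_nonneg (F : R -> R) (w l : R) : Prop :=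
  filterlim (fun y => (F y - F w) / (y - w))
    (within (fun y => 0 <= y) (locally' w)) (locally l).

Record SQ_ISM_equilibrium (d A : nat) (lam pi0 : R) (u : nat -> R) : Prop := {
  SQ_pi0 : 0 < pi0 <= 1;
  SQ_tail : is_queue_tail u;
  SQ_u1 : u 1%nat = lam;
  SQ_rec : forall k, (1 <= k)%nat -> u (k + 1)%nat = lam * pi0 * u k ^ d;
  SQ_memory : ISM_memory A lam (u 1%nat - u 2%nat) pi0
}.

Record LL_ISM_equilibrium (d A : nat) (lam pi0 : R) (F : R -> R) : Prop := {
  LL_pi0 : 0 < pi0 <= 1;
  LL_ccdf : is_workload_ccdf F;
  LL_F0 : F 0 = lam;
  LL_ode : forall w, 0 <= w -> is_derive_nonneg F w (lam * pi0 * F w ^ d - F w);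
  LL_memory : exists kappa, is_derive_nonneg F 0 (- kappa) /\ ISM_memory A lam kappa pi0
}.

(** The index [k] of the series stands for [k + 1], so that the sum starts at 1.
    [Series] and [RInt_gen] are only meaningful under the finiteness
    predicates stated next to them. *)
Definition SQ_mean_response (d : nat) (pi0 : R) (u : nat -> R) : R :=
  1 + pi0 * Series (fun k => u (k + 1)%nat ^ d).

Definition SQ_mean_finite (d : nat) (u : nat -> R) : Prop :=
  ex_series (fun k => u (k + 1)%nat ^ d).

Definition LL_mean_response (d : nat) (pi0 : R) (F : R -> R) : R :=
  1 + pi0 * RInt_gen (fun w => F w ^ d) (at_point 0) (Rbar_locally p_infty).

Definition LL_mean_finite (d : nat) (F : R -> R) : Prop :=
  ex_RInt_gen (fun w => F w ^ d) (at_point 0) (Rbar_locally p_infty).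

(* Main.v *)
(** Detailed balance for the memory chain gives
    [pi0 (1 - r^(A+1)) = 1 - r] with [r = kappa / lam], and in both models
    [kappa = lam - lam pi0 lam^d], i.e. [r = 1 - pi0 lam^d].  Hence
    [r^(A+1) = 1 - lam^d], so that [ln r ~ ln (1 - lam) / (A + 1)], and it
    remains to see that each mean response time is, up to a bounded error, a
    constant times [- ln r].

    LL(d): with [q = lam pi0], the function
    [- ln (1 - q F^(d-1)) / (q (d - 1))] has derivative [- F^(d-1)] along the
    ODE, and [F^(d-1) + F' <= F^d <= F^(d-1)].  Integrating,
    [int F^d] differs from [- ln r / (q (d - 1))] by at most [F 0].

    SQ(d): with [x = - ln (1 - r) / (d - 1)] the recursion is solved by
    [u_(k+1) = lam exp (x - d^k x)], so the mean is governed by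
    [sum_(k >= 1) exp (- d^k x)].  This sum is compared, term by term, with the
    telescoping differences of [ln (1 + 1/y) / ln d] along [y = d^k x]; the
    errors are in turn dominated by telescoping differences of
    [1 / (1 + y)]. *)

Require Import Defs.
From Stdlib Require Import Reals Lra Lia.
From Coquelicot Require Import Coquelicot.
Open Scope R_scope.

Lemma ln_le_minus_1 (x : R) : 0 < x -> ln x <= x - 1.
Proof.
  intros hx; assert (H := exp_ineq1_le (ln x)).
  rewrite exp_ln in H by exact hx; lra.
Qed.


(** * Stationary law of the memory chain *)

Lemma birth_death_geometric (A : nat) (kappa lam : R) (p : nat -> R) :
  0 < lam -> birth_death_stationary A kappa lam p ->
  forall i, (i <= A)%nat -> p i = (kappa / lam) ^ i * p 0%nat.
Proof.
  intros hlam [_ [_ bal]].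
  (* The net flux across each edge vanishes: balance at 0 is the base case, and balance at [S i]
     minus the identity for [i] gives the next edge. *)
  assert (detailed : forall i, (i < A)%nat -> lam * p (S i) = kappa * p i).
  { induction i as [|i IH]; intros hi.
    - specialize (bal 0%nat (Nat.lt_le_incl _ _ hi)).
      rewrite (proj2 (Nat.ltb_lt _ _) hi) in bal; simpl in bal; lra.
    - specialize (IH (Nat.lt_succ_l _ _ hi)).
      specialize (bal (S i) (Nat.lt_le_incl _ _ hi)).
      rewrite (proj2 (Nat.ltb_lt _ _) hi) in bal.
      replace (S i - 1)%nat with i in bal by lia.
      replace (S i + 1)%nat with (S (S i)) in bal by lia.
      simpl in bal; lra. }
  induction i as [|i IH]; intros hi; [simpl; ring|].
  assert (E := detailed i hi); rewrite IH in E by lia.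
  apply (Rmult_eq_reg_l lam); [|lra].
  rewrite E; simpl; field; lra.
Qed.

(** The normalisation of the geometric law, multiplied through by [1 - kappa / lam] so that the case
    [kappa = lam] needs no separate treatment. *)
Lemma ISM_memory_geometric_sum (A : nat) (lam kappa pi0 : R) :
  0 < lam -> ISM_memory A lam kappa pi0 ->
  pi0 * (1 - (kappa / lam) ^ S A) = 1 - kappa / lam.
Proof.
  intros hlam [p [st ->]].
  assert (geo := birth_death_geometric _ _ _ _ hlam st).
  destruct st as [_ [tot _]].
  set (r := kappa / lam) in *.
  assert (E : forall n, (n <= A)%nat ->
    (1 - r) * sum_f_R0 p n = p 0%nat * (1 - r ^ S n)).
  { induction n as [|n IH]; intros hn; [simpl; ring|].
    simpl sum_f_R0; rewrite Rmult_plus_distr_l, IH, (geo (S n)) by lia.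
    simpl; ring. }
  rewrite <- E, tot by lia; ring.
Qed.

(** With this birth rate both sides of the geometric-sum identity carry a factor [pi0 > 0];
    cancelling it makes the self-consistency condition explicit in [lam]. *)
Lemma ISM_memory_ratio (d A : nat) (lam pi0 : R) :
  (1 <= d)%nat -> 0 < lam < 1 -> 0 < pi0 <= 1 ->
  ISM_memory A lam (lam - lam * pi0 * lam ^ d) pi0 ->
  0 < 1 - pi0 * lam ^ d < 1 /\ (1 - pi0 * lam ^ d) ^ S A = 1 - lam ^ d.
Proof.
  intros hd hlam hpi mem.
  apply ISM_memory_geometric_sum in mem; [|lra].
  replace ((lam - lam * pi0 * lam ^ d) / lam) with (1 - pi0 * lam ^ d)
    in mem by (field; lra).
  assert (0 < lam ^ d) by (apply pow_lt; lra).
  assert (lam ^ d < 1) by (apply pow_lt_1_compat; [lra|lia]).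
  repeat split; nra.
Qed.

(** * Logarithmic scale of the memory ratio as [lam] tends to 1 *)

Lemma bernoulli_complement (d : nat) (x : R) :
  0 <= x <= 1 -> 1 - x ^ d <= INR d * (1 - x).
Proof.
  intros hx; induction d as [|d IH]; [simpl; lra|].
  rewrite S_INR; simpl pow.
  assert (0 <= x ^ d <= 1).
  { split; [apply pow_le; lra|].
    rewrite <- (pow1 d); apply pow_incr; lra. }
  nra.
Qed.

(** Since [1 - lam <= 1 - lam^d <= d (1 - lam)], the logarithms of the outer and middle terms differ
    by at most [ln d], and dividing by [A + 1 >= 1] keeps this bound. *)
Lemma log_ratio_bound (d A : nat) (lam r : R) :
  (1 <= d)%nat -> 0 < lam < 1 -> 0 < r -> r ^ S A = 1 - lam ^ d ->
  Rabs (- ln r - 1 / (INR A + 1) * - ln (1 - lam)) <= ln (INR d).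
Proof.
  intros hd hlam hr E.
  assert (hA := pos_INR A).
  assert (hd' : 1 <= INR d) by (apply (le_INR 1); exact hd).
  assert (E' : (INR A + 1) * ln r = ln (1 - lam ^ d)).
  { rewrite <- E, ln_pow, S_INR by exact hr; reflexivity. }
  assert (lo : ln (1 - lam) <= ln (1 - lam ^ d)).
  { apply ln_le; [lra|].
    destruct d as [|d]; [lia|].
    assert (lam ^ d <= 1) by (rewrite <- (pow1 d); apply pow_incr; lra).
    simpl; nra. }
  assert (up : ln (1 - lam ^ d) <= ln (INR d) + ln (1 - lam)).
  { rewrite <- ln_mult by lra.
    apply ln_le; [|apply bernoulli_complement; lra].
    rewrite <- E; apply pow_lt, hr. }
  assert (0 <= ln (INR d)) by (rewrite <- ln_1; apply ln_le; lra).
  replace (- ln r - 1 / (INR A + 1) * - ln (1 - lam))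
    with (- (ln (1 - lam ^ d) - ln (1 - lam)) / (INR A + 1))
    by (rewrite <- E'; field; lra).
  rewrite Rabs_left1.
  - apply (Rmult_le_reg_r (INR A + 1)); [lra|].
    unfold Rdiv; rewrite Ropp_mult_distr_l, Rmult_assoc, Rinv_l by lra; nra.
  - unfold Rdiv.
    assert (0 < / (INR A + 1)) by (apply Rinv_0_lt_compat; lra).
    nra.
Qed.

Lemma at_left_1_interval (a : R) :
  a < 1 -> at_left 1 (fun lam => a < lam < 1).
Proof.
  intros ha.
  exists (mkposreal (1 - a) ltac:(lra)); intros y hy hy1.
  apply Rabs_lt_between' in hy; simpl in hy; lra.
Qed.

Lemma bounded_over_log (f : R -> R) (K : R) :
  at_left 1 (fun lam => Rabs (f lam) <= K) ->
  filterlim (fun lam => f lam / ln (1 - lam)) (at_left 1) (locally 0).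
Proof.
  intros hf; apply filterlim_locally; intros eps.
  assert (heps := cond_pos eps).
  (* Chosen so that [eps * M = Rabs K + 1 > K]; once [- ln (1 - lam)] exceeds [M], the quotient is
     below [eps]. *)
  set (M := (Rabs K + 1) / eps).
  assert (hM : 0 < M) by (apply Rdiv_lt_0_compat; [assert (H := Rabs_pos K); lra|lra]).
  assert (hex : 0 < exp (- M) < 1).
  { split; [apply exp_pos|]. rewrite <- exp_0; apply exp_increasing; lra. }
  generalize (at_left_1_interval (1 - exp (- M)) ltac:(lra)).
  intros hl; generalize (filter_and _ _ hf hl); apply filter_imp.
  intros lam [hK hlam].
  assert (hln : ln (1 - lam) < - M).
  { rewrite <- (ln_exp (- M)); apply ln_increasing; lra. }
  change (Rabs (f lam / ln (1 - lam) - 0) < eps).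
  rewrite Rminus_0_r.
  unfold Rdiv; rewrite Rabs_mult, Rabs_inv, (Rabs_left (ln (1 - lam))) by lra.
  apply (Rmult_lt_reg_r (- ln (1 - lam))); [lra|].
  rewrite Rmult_assoc, Rinv_l, Rmult_1_r by lra.
  apply Rle_lt_trans with (1 := hK).
  apply Rlt_trans with (eps * M); [|apply Rmult_lt_compat_l; lra].
  unfold M; replace (eps * ((Rabs K + 1) / eps)) with (Rabs K + 1) by (field; lra).
  assert (H := Rle_abs K); lra.
Qed.

(** The step common to both models: [m] is the prefactor of [- ln r] in the mean response time and
    [m0] its heavy-traffic limit. Two bounded errors, in the mean and in [ln r], vanish after
    division by [ln (1 - lam)]. *)
Lemma mean_over_log_limit (d A : nat) (r m Rm : R -> R) (m0 K : R) :
  (1 <= d)%nat ->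
  (forall lam, 0 < lam < 1 -> 0 < r lam /\ r lam ^ S A = 1 - lam ^ d) ->
  filterlim m (at_left 1) (locally m0) ->
  at_left 1 (fun lam => Rabs (Rm lam - m lam * - ln (r lam)) <= K) ->
  filterlim (fun lam => - (Rm lam / ln (1 - lam))) (at_left 1)
    (locally (1 / (INR A + 1) * m0)).
Proof.
  intros hd hr hm hR.
  assert (int01 := at_left_1_interval 0 Rlt_0_1).
  set (c := 1 / (INR A + 1)).
  assert (H1 : filterlim
    (fun lam => (- ln (r lam) - c * - ln (1 - lam)) / ln (1 - lam))
    (at_left 1) (locally 0)).
  { apply bounded_over_log with (ln (INR d)).
    revert int01; apply filter_imp; intros lam hlam.
    destruct (hr lam hlam); apply log_ratio_bound; assumption. }
  assert (H2 := bounded_over_log _ _ hR).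
  replace (c * m0) with (- (0 + m0 * (0 - c))) by ring.
  eapply (filterlim_ext_loc (fun lam =>
    - ((Rm lam - m lam * - ln (r lam)) / ln (1 - lam)
       + m lam * ((- ln (r lam) - c * - ln (1 - lam)) / ln (1 - lam) - c)))).
  { revert int01; apply filter_imp; intros lam hlam.
    assert (ln (1 - lam) < 0) by (rewrite <- ln_1; apply ln_increasing; lra).
    field; lra. }
  assert (H3 := filterlim_comp_2 (G := locally 0) (H := locally (- c)) (F := at_left 1)
    _ (fun _ => - c) Rplus H1 (filterlim_const _) (filterlim_plus 0 (- c))).
  assert (H4 := filterlim_comp_2 _ _ Rmult hm H3 (filterlim_mult m0 (0 - c))).
  assert (H5 := filterlim_comp_2 _ _ Rplus H2 H4 (filterlim_plus 0 (m0 * (0 - c)))).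
  exact (filterlim_comp _ _ _ _ Ropp _ _ _ H5 (filterlim_opp (0 + m0 * (0 - c)))).
Qed.

Lemma ratio_tends_to_0 (d A : nat) (r : R -> R) :
  (1 <= d)%nat ->
  (forall lam, 0 < lam < 1 -> 0 < r lam /\ r lam ^ S A = 1 - lam ^ d) ->
  filterlim r (at_left 1) (locally 0).
Proof.
  intros hd hr; apply filterlim_locally; intros eps.
  assert (heps := cond_pos eps).
  assert (hd' : 1 <= INR d) by (apply (le_INR 1); exact hd).
  assert (hp : 0 < eps ^ S A / INR d)
    by (apply Rdiv_lt_0_compat; [apply pow_lt|]; lra).
  generalize (filter_and _ _ (at_left_1_interval 0 Rlt_0_1)
    (at_left_1_interval (1 - eps ^ S A / INR d) ltac:(lra))).
  apply filter_imp; intros lam [hlam hlam'].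
  destruct (hr lam hlam) as [h0 E].
  change (Rabs (r lam - 0) < eps); rewrite Rminus_0_r, Rabs_pos_eq by lra.
  destruct (Rlt_le_dec (r lam) eps) as [|hle]; [assumption|exfalso].
  assert (eps ^ S A <= r lam ^ S A) by (apply pow_incr; lra).
  assert (B := bernoulli_complement d lam ltac:(lra)).
  assert (INR d * (1 - lam) < INR d * (eps ^ S A / INR d))
    by (apply Rmult_lt_compat_l; lra).
  replace (INR d * (eps ^ S A / INR d)) with (eps ^ S A) in * by (field; lra).
  lra.
Qed.

(** * Integral of the workload tail *)

Lemma within_nonneg_proper (w : R) :
  0 <= w -> ProperFilter' (within (fun y => 0 <= y) (locally' w)).
Proof.
  intros hw; split; [|apply within_filter, locally'_filter].
  intros [e H].
  assert (he := cond_pos e).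
  apply (H (w + e / 2)); [|lra|lra].
  change (Rabs (w + e / 2 - w) < e).
  rewrite Rabs_pos_eq; lra.
Qed.

(** Used at [w = 0], where it identifies the [kappa] of the memory chain with the value given by the
    ODE. *)
Lemma is_derive_nonneg_unique (F : R -> R) (w l l' : R) :
  0 <= w -> is_derive_nonneg F w l -> is_derive_nonneg F w l' -> l = l'.
Proof.
  intros hw; exact (filterlim_locally_unique (V := R_NormedModule)
    (FF := within_nonneg_proper w hw) _ l l').
Qed.

Lemma is_derive_nonneg_interior (F : R -> R) (w l : R) :
  0 < w -> is_derive_nonneg F w l -> is_derive F w l.
Proof.
  intros hw H; apply is_derive_Reals; intros eps heps.
  destruct (proj1 (filterlim_locally _ _) H (mkposreal eps heps)) as [e He].
  assert (he := cond_pos e).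
  (* Capping the radius at [w] keeps [w + h] in the half-line. *)
  assert (hmin : 0 < Rmin e w) by (apply Rmin_glb_lt; lra).
  exists (mkposreal _ hmin); intros h hne hh; simpl in hh.
  assert (Rabs h < e) by (apply Rlt_le_trans with (1 := hh), Rmin_l).
  assert (Rabs h < w) by (apply Rlt_le_trans with (1 := hh), Rmin_r).
  assert (- w < h) by (apply Rabs_def2 in H1; lra).
  specialize (He (w + h)).
  replace (w + h - w) with h in He by ring.
  apply He; [|lra|lra].
  change (Rabs (w + h - w) < e).
  replace (w + h - w) with h by ring; assumption.
Qed.

(** Constant extension to the left of 0 turns right-continuity at 0 into two-sided continuity, and
    leaves integrals over [[0, w]] unchanged. *)
Lemma continuous_clamp (F : R -> R) :
  (forall w, 0 < w -> continuous F w) ->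
  filterlim F (at_right 0) (locally (F 0)) ->
  forall w, continuous (fun x => F (Rmax 0 x)) w.
Proof.
  intros hF h0 w.
  destruct (Rtotal_order w 0) as [hw|[->|hw]].
  - apply (continuous_ext_loc _ (fun _ => F 0)); [|apply continuous_const].
    exists (mkposreal (- w) ltac:(lra)); intros y hy.
    apply Rabs_lt_between' in hy; simpl in hy.
    rewrite Rmax_left; [reflexivity|lra].
  - apply filterlim_locally; intros eps.
    rewrite Rmax_left by lra.
    destruct (proj1 (filterlim_locally _ _) h0 eps) as [e He].
    exists e; intros y hy.
    destruct (Rlt_le_dec 0 y).
    + rewrite Rmax_right by lra; apply He; assumption.
    + rewrite Rmax_left by lra; apply ball_center.
  - apply (continuous_ext_loc _ F).
    + exists (mkposreal w hw); intros y hy.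
      apply Rabs_lt_between' in hy; simpl in hy.
      rewrite Rmax_right; [reflexivity|lra].
    + apply hF, hw.
Qed.

(** Differentiability is asked on the open interval only, because the clamped workload tail may have
    a corner at 0. *)
Lemma nonneg_derive_le (f df : R -> R) (a b : R) :
  a <= b ->
  (forall x, a < x < b -> is_derive f x (df x)) ->
  (forall x, a <= x <= b -> 0 <= df x) ->
  (forall x, a <= x <= b -> continuous f x) ->
  f a <= f b.
Proof.
  intros hab hd hpos hc.
  destruct (MVT_gen f a b df) as [c [hc' E]].
  - rewrite Rmin_left, Rmax_right by lra; exact hd.
  - rewrite Rmin_left, Rmax_right by lra; intros x hx.
    apply continuity_pt_filterlim, hc, hx.
  - rewrite Rmin_left, Rmax_right in hc' by lra.
    assert (0 <= df c * (b - a)) by (apply Rmult_le_pos; [apply hpos, hc'|lra]).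
    lra.
Qed.


(** The partial integrals converge to their supremum. The lower bound is approached only up to [e],
    matching estimates whose boundary term vanishes at infinity. *)
Lemma is_RInt_gen_monotone_bounded (f : R -> R) (lo hi : R) :
  (forall w, 0 <= w -> ex_RInt f 0 w) ->
  (forall v w, 0 <= v <= w -> RInt f 0 v <= RInt f 0 w) ->
  (forall w, 0 <= w -> RInt f 0 w <= hi) ->
  (forall e, 0 < e -> exists w, 0 <= w /\ lo - e <= RInt f 0 w) ->
  exists l : R, is_RInt_gen f (at_point 0) (Rbar_locally p_infty) l /\ lo <= l <= hi.
Proof.
  intros hex hmon hhi hlo.
  set (E := fun y => exists w, 0 <= w /\ y = RInt f 0 w).
  destruct (completeness E) as [l [ub lub]].
  - exists hi; intros y [w [hw ->]]; apply hhi, hw.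
  - exists (RInt f 0 0), 0; split; [lra|reflexivity].
  - exists l; split; [|split].
    + apply (filterlimi_lim_ext_loc (fun ab => RInt f 0 (snd ab))).
      * exists (fun a => a = 0) (fun b => 0 < b); [reflexivity|exists 0; auto|].
        intros a b -> hb; simpl; apply (RInt_correct f), hex; simpl; lra.
      * apply (filterlim_comp _ _ _ snd (fun b => RInt f 0 b) _ _ _ filterlim_snd).
        apply filterlim_locally; intros eps.
        assert (heps := cond_pos eps).
        assert (hw : exists w, 0 <= w /\ l - eps < RInt f 0 w).
        { apply Classical_Prop.NNPP; intros hn.
          assert (l <= l - eps); [apply lub|lra].
          intros y [w [hw ->]]; apply Rnot_lt_le; intros hy.
          apply hn; exists w; split; assumption. }
        destruct hw as [w [hw hlt]].
        exists w; intros x hx.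
        assert (RInt f 0 w <= RInt f 0 x) by (apply hmon; lra).
        assert (RInt f 0 x <= l) by (apply ub; exists x; split; [lra|reflexivity]).
        change (Rabs (RInt f 0 x - l) < eps).
        rewrite Rabs_left1; lra.
    + apply Rle_plus_epsilon; intros e he.
      destruct (hlo e he) as [w [hw hle]].
      assert (RInt f 0 w <= l) by (apply ub; exists w; split; [lra|reflexivity]).
      lra.
    + apply lub; intros y [w [hw ->]]; apply hhi, hw.
Qed.

(** An antiderivative of [x^(d-2) / (1 - q x^(d-1))], that is, of [x^(d-1)] divided by the speed
    [x - q x^d] at which the tail decreases. *)
Definition workload_potential (d : nat) (q x : R) : R :=
  - ln (1 - q * x ^ (d - 1)) / (q * (INR d - 1)).

Section Workload.

Variables (d : nat) (q : R) (F : R -> R).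
Hypotheses (hd : (2 <= d)%nat) (hq : 0 < q < 1).
Hypothesis F_range : forall w, 0 <= w -> 0 <= F w <= 1.
Hypothesis F_right : filterlim F (at_right 0) (locally (F 0)).
Hypothesis F_ode : forall w, 0 < w -> is_derive F w (q * F w ^ d - F w).
Hypothesis F_lim : is_lim F p_infty 0.

Let G (w : R) : R := F (Rmax 0 w).
Let Phi (w : R) : R := workload_potential d q (G w).

Lemma clamp_nonneg w : 0 <= w -> G w = F w.
Proof. intros hw; unfold G; rewrite Rmax_right; [reflexivity|exact hw]. Qed.

Lemma clamp_range w : 0 <= G w <= 1.
Proof. apply F_range, Rmax_l. Qed.

Lemma clamp_continuous w : continuous G w.
Proof.
  apply continuous_clamp; [|exact F_right].
  intros v hv; apply (ex_derive_continuous F); eexists; apply F_ode, hv.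
Qed.

Lemma clamp_ode w : 0 < w -> is_derive G w (q * G w ^ d - G w).
Proof.
  intros hw; rewrite clamp_nonneg by lra.
  apply (is_derive_ext_loc F); [|apply F_ode, hw].
  exists (mkposreal w hw); intros y hy.
  apply Rabs_lt_between' in hy; simpl in hy.
  rewrite clamp_nonneg; [reflexivity|lra].
Qed.

Lemma clamp_gap w : 0 < 1 - q * G w ^ (d - 1).
Proof.
  assert (0 <= G w ^ (d - 1) <= 1).
  { assert (H := clamp_range w); split; [apply pow_le; lra|].
    rewrite <- (pow1 (d - 1)); apply pow_incr; lra. }
  nra.
Qed.

Lemma d_minus_1_ge_1 : 1 <= INR d - 1.
Proof. apply (le_INR 2) in hd; simpl in hd; lra. Qed.

Lemma potential_continuous w : continuous Phi w.
Proof.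
  apply (continuous_comp G (workload_potential d q)); [apply clamp_continuous|].
  apply (ex_derive_continuous (workload_potential d q)).
  assert (H := clamp_gap w); unfold workload_potential; auto_derive; tauto.
Qed.

Lemma potential_derive w : 0 < w -> is_derive Phi w (- G w ^ (d - 1)).
Proof.
  intros hw.
  assert (H := clamp_gap w); assert (D := d_minus_1_ge_1).
  replace (- G w ^ (d - 1)) with ((q * G w ^ d - G w) *
    (INR (d - 1) * G w ^ (d - 2) / ((1 - q * G w ^ (d - 1)) * (INR d - 1)))).
  - apply (is_derive_comp (workload_potential d q) G); [|apply clamp_ode, hw].
    unfold workload_potential; auto_derive; [exact H|].
    replace (pred (d - 1)) with (d - 2)%nat by lia.
    field; repeat split; lra.
  - rewrite minus_INR by lia; simpl (INR 1).
    (* The cancellation is [x^(d-2) (q x^d - x) = - x^(d-1) (1 - q x^(d-1))]. *)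
    replace d with (S (S (d - 2))) at 1 by lia.
    replace (d - 1)%nat with (S (d - 2)) in * by lia.
    simpl in *; field; split; lra.
Qed.

Lemma clamp_pow_continuous w : continuous (fun x => G x ^ d) w.
Proof.
  apply (continuous_comp G (fun y => y ^ d)); [apply clamp_continuous|].
  apply (ex_derive_continuous (fun y => y ^ d)); auto_derive; exact I.
Qed.

Lemma clamp_pow_integrable a b : ex_RInt (fun x => G x ^ d) a b.
Proof.
  apply (ex_RInt_continuous (fun x => G x ^ d)).
  intros; apply clamp_pow_continuous.
Qed.

Let I (w : R) : R := RInt (fun x => G x ^ d) 0 w.

Lemma integral_derive w : is_derive I w (G w ^ d).
Proof.
  apply (is_derive_RInt (fun x => G x ^ d) I 0); [|apply clamp_pow_continuous].
  apply filter_forall; intros b; apply (RInt_correct (fun x => G x ^ d)), clamp_pow_integrable.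
Qed.

Lemma integral_continuous w : continuous I w.
Proof. apply (ex_derive_continuous I); eexists; apply integral_derive. Qed.

Lemma clamp_pow_le w : G w ^ d <= G w ^ (d - 1).
Proof.
  assert (H := clamp_range w).
  replace d with (S (d - 1)) at 1 by lia; simpl.
  assert (0 <= G w ^ (d - 1)) by (apply pow_le; lra); nra.
Qed.

(* [x^(d-1) (1-x) <= x (1-x) <= x (1 - q x^(d-1))] on [[0, 1]]. *)
Lemma clamp_pow_ge w :
  G w ^ (d - 1) + (q * G w ^ d - G w) <= G w ^ d.
Proof.
  assert (H := clamp_range w).
  replace d with (S (S (d - 2))) by lia.
  replace (S (S (d - 2)) - 1)%nat with (S (d - 2)) by lia; simpl.
  assert (0 <= G w ^ (d - 2) <= 1).
  { split; [apply pow_le; lra|].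
    rewrite <- (pow1 (d - 2)); apply pow_incr; lra. }
  assert (0 <= G w * (1 - G w) * (1 - G w ^ (d - 2)))
    by (repeat apply Rmult_le_pos; lra).
  assert (0 <= G w * G w * (1 - q * G w ^ (d - 2))).
  { repeat apply Rmult_le_pos; nra. }
  nra.
Qed.

(** [I + Phi] has derivative [G^d - G^(d-1) <= 0]. *)
Lemma integral_upper v w : 0 <= v <= w -> I w + Phi w <= I v + Phi v.
Proof.
  intros hvw; apply Ropp_le_cancel.
  apply (nonneg_derive_le (fun x => - (I x + Phi x))
    (fun x => - (G x ^ d + - G x ^ (d - 1)))); [lra| | |].
  - intros x hx; apply (is_derive_opp (fun x => I x + Phi x)).
    apply (is_derive_plus I Phi); [apply integral_derive|apply potential_derive; lra].
  - intros x _; assert (H := clamp_pow_le x); lra.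
  - intros x _; apply (continuous_opp (fun x => I x + Phi x)).
    apply (continuous_plus I Phi); [apply integral_continuous|apply potential_continuous].
Qed.

(** Subtracting [G] reverses the monotonicity: the derivative is now [G^d - G^(d-1) - G'],
    nonnegative by [clamp_pow_ge]. *)
Lemma integral_lower v w :
  0 <= v <= w -> I v + Phi v - G v <= I w + Phi w - G w.
Proof.
  intros hvw.
  apply (nonneg_derive_le (fun x => I x + Phi x - G x)
    (fun x => G x ^ d + - G x ^ (d - 1) - (q * G x ^ d - G x))); [lra| | |].
  - intros x hx; apply (is_derive_minus (fun x => I x + Phi x) G); [|apply clamp_ode; lra].
    apply (is_derive_plus I Phi); [apply integral_derive|apply potential_derive; lra].
  - intros x _; assert (H := clamp_pow_ge x); lra.
  - intros x _; apply (continuous_minus (fun x => I x + Phi x) G); [|apply clamp_continuous].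
    apply (continuous_plus I Phi); [apply integral_continuous|apply potential_continuous].
Qed.

Lemma potential_nonneg w : 0 <= Phi w.
Proof.
  assert (H := clamp_gap w); assert (D := d_minus_1_ge_1).
  assert (hl := ln_le_minus_1 _ H).
  assert (0 <= q * G w ^ (d - 1)).
  { apply Rmult_le_pos; [lra|]; apply pow_le, clamp_range. }
  apply Rdiv_le_0_compat; [lra|]; apply Rmult_lt_0_compat; lra.
Qed.

(** For [y = q G^(d-1) <= q G <= 1/2], [- ln (1 - y) <= 1 / (1 - y) - 1 <= 2 y]; the factor [q] then
    cancels. This controls the boundary term at infinity. *)
Lemma potential_small w : G w <= 1 / 2 -> Phi w <= 2 * G w.
Proof.
  intros hG; assert (H := clamp_gap w); assert (D := d_minus_1_ge_1).
  assert (hr := clamp_range w).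
  unfold Phi, workload_potential; set (y := q * G w ^ (d - 1)) in *.
  assert (hy : 0 <= y <= q * G w).
  { unfold y; replace (d - 1)%nat with (S (d - 2)) by lia; simpl.
    assert (0 <= G w ^ (d - 2) <= 1).
    { split; [apply pow_le; lra|].
      rewrite <- (pow1 (d - 2)); apply pow_incr; lra. }
    assert (0 <= G w * G w ^ (d - 2)) by (apply Rmult_le_pos; lra).
    assert (0 <= G w * (1 - G w ^ (d - 2))) by (apply Rmult_le_pos; lra).
    split; nra. }
  assert (hl := ln_le_minus_1 (/ (1 - y)) (Rinv_0_lt_compat _ H)).
  rewrite ln_Rinv in hl by exact H.
  assert (y <= 1 / 2) by nra.
  assert (hy2 : / (1 - y) - 1 <= 2 * y).
  { apply (Rmult_le_reg_r (1 - y)); [exact H|].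
    rewrite Rmult_minus_distr_r, Rinv_l by lra; nra. }
  apply (Rmult_le_reg_r (q * (INR d - 1))); [apply Rmult_lt_0_compat; lra|].
  unfold Rdiv; rewrite Rmult_assoc, Rinv_l by (apply Rgt_not_eq, Rmult_lt_0_compat; lra).
  assert (0 <= q * G w * (INR d - 2)) by (repeat apply Rmult_le_pos; lra).
  lra.
Qed.

Lemma workload_integral :
  exists l : R, is_RInt_gen (fun w => F w ^ d) (at_point 0) (Rbar_locally p_infty) l /\
    workload_potential d q (F 0) - F 0 <= l <= workload_potential d q (F 0).
Proof.
  assert (P0 : I 0 = 0) by exact (RInt_point 0 (fun x => G x ^ d)).
  assert (I_F : forall w, 0 <= w -> is_RInt (fun x => F x ^ d) 0 w (I w)).
  { intros w hw; apply (is_RInt_ext (fun x => G x ^ d)).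
    - rewrite Rmin_left, Rmax_right by exact hw; intros x hx.
      rewrite clamp_nonneg; [reflexivity|lra].
    - apply (RInt_correct (fun x => G x ^ d)), clamp_pow_integrable. }
  assert (I_F' : forall w, 0 <= w -> RInt (fun x => F x ^ d) 0 w = I w).
  { intros w hw; apply is_RInt_unique, I_F, hw. }
  assert (Phi0 : Phi 0 = workload_potential d q (F 0))
    by (unfold Phi; rewrite clamp_nonneg by lra; reflexivity).
  rewrite <- Phi0, <- clamp_nonneg by lra.
  apply is_RInt_gen_monotone_bounded.
  - intros w hw; eexists; apply I_F, hw.
  - intros v w hvw; rewrite !I_F' by lra.
    apply (nonneg_derive_le I (fun x => G x ^ d)); [lra| | |].
    + intros x _; apply integral_derive.
    + intros x _; apply pow_le, clamp_range.
    + intros x _; apply integral_continuous.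
  - intros w hw; rewrite I_F' by exact hw.
    assert (H := integral_upper 0 w ltac:(lra)).
    assert (H' := potential_nonneg w); lra.
  - intros e he.
    (* At a [w] with [G w] this small, [integral_lower] loses at most [Phi w - G w <= G w < e]; the
       bound [1 / 2] is what [potential_small] requires. *)
    assert (hm : 0 < Rmin (1 / 2) (e / 2)) by (apply Rmin_glb_lt; lra).
    assert (hev := proj1 (filterlim_locally _ _) F_lim (mkposreal _ hm)).
    destruct hev as [M hM].
    exists (Rmax 0 M + 1).
    assert (h0 := Rmax_l 0 M); assert (h1 := Rmax_r 0 M).
    set (w := Rmax 0 M + 1) in *.
    specialize (hM w ltac:(unfold w; lra)).
    change (Rabs (F w - 0) < Rmin (1 / 2) (e / 2)) in hM.
    rewrite Rminus_0_r, <- clamp_nonneg, Rabs_pos_eq in hM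
      by (try apply clamp_range; unfold w; lra).
    assert (m1 := Rmin_l (1 / 2) (e / 2)); assert (m2 := Rmin_r (1 / 2) (e / 2)).
    split; [unfold w; lra|].
    rewrite I_F' by (unfold w; lra).
    assert (H := integral_lower 0 w ltac:(unfold w; lra)).
    assert (H' := potential_small w ltac:(lra)).
    assert (H'' := clamp_range w); lra.
Qed.

End Workload.

(** * Sums of double exponentials *)

(** A smooth count of the [n] with [d^n x < 1], about [- ln x / ln d] for small [x]; the 1 inside
    the logarithm makes it vanish at infinity. *)
Definition queue_potential (d x : R) : R := ln (1 + / x) / ln d.

(** The constant comes from [x <= 1]: the error there is at most [2 (1 + 1 / ln d) (d - 1) x], while
    [1 / (1 + x)] drops by at least [(d - 1) x / (2 (d + 1))]. *)
Definition potential_error (d x : R) : R :=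
  4 * (d + 1) * (1 + / ln d) * / (1 + x).

Lemma ln_gt_0 (x : R) : 1 < x -> 0 < ln x.
Proof. intros hx; rewrite <- ln_1; apply ln_increasing; lra. Qed.

(* For small [x] both the potential drop and [exp (- x)] are [1 - O(x)], for
   large [x] both are [O(1 / x)]; the drop of [1 / (1 + x)] dominates both errors. *)
Lemma queue_potential_drop (d x : R) :
  2 <= d -> 0 < x ->
  Rabs (exp (- x) - (queue_potential d x - queue_potential d (d * x)))
    <= potential_error d x - potential_error d (d * x).
Proof.
  intros hd hx.
  assert (hld := ln_gt_0 d ltac:(lra)).
  assert (hdx : 0 < d * x) by nra.
  set (D := queue_potential d x - queue_potential d (d * x)).
  set (il := / ln d).
  assert (hil : 0 < il) by (apply Rinv_0_lt_compat, hld).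
  assert (ED : D = il * ln (d * (x + 1) / (d * x + 1))).
  { unfold D, queue_potential, il.
    replace (d * (x + 1) / (d * x + 1)) with ((1 + / x) / (1 + / (d * x)))
      by (field; repeat split; nra).
    assert (0 < / x) by (apply Rinv_0_lt_compat; lra).
    assert (0 < / (d * x)) by (apply Rinv_0_lt_compat; lra).
    rewrite ln_div by lra; field; lra. }
  (* The complementary form serves small [x], where the drop and [exp (- x)] are both close to 1. *)
  assert (ED' : 1 - D = il * ln ((d * x + 1) / (x + 1))).
  { rewrite ED.
    replace ((d * x + 1) / (x + 1)) with (d / (d * (x + 1) / (d * x + 1)))
      by (field; repeat split; nra).
    rewrite (ln_div d) by (try apply Rdiv_lt_0_compat; nra).
    unfold il; field; lra. }
  assert (hdx1 : 0 < d * x + 1) by lra.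
  assert (D0 : 0 <= D).
  { rewrite ED; apply Rmult_le_pos; [lra|].
    rewrite <- ln_1; apply ln_le; [lra|].
    apply (Rmult_le_reg_r (d * x + 1)); [lra|].
    replace (d * (x + 1) / (d * x + 1) * (d * x + 1)) with (d * (x + 1)) by (field; lra).
    lra. }
  assert (D1 : 0 <= 1 - D).
  { rewrite ED'; apply Rmult_le_pos; [lra|].
    rewrite <- ln_1; apply ln_le; [lra|].
    apply (Rmult_le_reg_r (x + 1)); [lra|].
    replace ((d * x + 1) / (x + 1) * (x + 1)) with (d * x + 1) by (field; lra).
    nra. }
  assert (e0 := exp_pos (- x)).
  assert (e1 : exp (- x) <= 1) by (rewrite <- exp_0; left; apply exp_increasing; lra).
  assert (drop : potential_error d x - potential_error d (d * x) =
    4 * (d + 1) * (1 + il) * ((d - 1) * x / ((1 + x) * (1 + d * x)))).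
  { unfold potential_error, il; field; repeat split; lra. }
  rewrite drop; clear drop.
  destruct (Rle_lt_dec x 1) as [hx1|hx1].
  - assert (hexp : 1 - exp (- x) <= x) by (assert (H := exp_ineq1_le (- x)); lra).
    assert (hD : 1 - D <= il * ((d - 1) * x)).
    { rewrite ED'; apply Rmult_le_compat_l; [lra|].
      assert (0 < (d * x + 1) / (x + 1)) by (apply Rdiv_lt_0_compat; lra).
      eapply Rle_trans; [apply ln_le_minus_1; assumption|].
      replace ((d * x + 1) / (x + 1) - 1) with ((d - 1) * x * / (x + 1)) by (field; lra).
      assert (/ (x + 1) <= 1) by (rewrite <- Rinv_1; apply Rinv_le_contravar; lra).
      assert (0 <= (d - 1) * x) by nra; nra. }
    assert (hg : (d - 1) * x * (/ (2 * (d + 1))) <=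
      (d - 1) * x / ((1 + x) * (1 + d * x))).
    { apply Rmult_le_compat_l; [nra|].
      apply Rinv_le_contravar; [nra|].
      apply Rmult_le_compat; nra. }
    apply Rle_trans with (2 * (1 + il) * ((d - 1) * x)).
    + assert (x <= (d - 1) * x) by nra.
      apply Rabs_le; split; nra.
    + replace (2 * (1 + il) * ((d - 1) * x)) with
        (4 * (d + 1) * (1 + il) * ((d - 1) * x * / (2 * (d + 1)))) by (field; lra).
      apply Rmult_le_compat_l; [|exact hg].
      repeat apply Rmult_le_pos; lra.
  - assert (hexp : exp (- x) <= / x).
    { rewrite exp_Ropp; apply Rinv_le_contravar; [lra|].
      assert (H := exp_ineq1_le x); lra. }
    assert (hix : 0 < / x) by (apply Rinv_0_lt_compat; lra).
    assert (hD : D <= il * / x).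
    { rewrite ED; apply Rmult_le_compat_l; [lra|].
      eapply Rle_trans; [apply ln_le_minus_1, Rdiv_lt_0_compat; nra|].
      replace (d * (x + 1) / (d * x + 1) - 1) with ((d - 1) / (d * x + 1)) by (field; lra).
      apply (Rmult_le_reg_r (x * (d * x + 1))); [nra|].
      replace ((d - 1) / (d * x + 1) * (x * (d * x + 1))) with ((d - 1) * x) by (field; lra).
      replace (/ x * (x * (d * x + 1))) with (d * x + 1) by (field; lra).
      lra. }
    (* For [x > 1], [1 + x <= 2 x] and [1 + d x <= 2 d x]. *)
    assert (hg : (d - 1) * / (4 * d * x) <= (d - 1) * x / ((1 + x) * (1 + d * x))).
    { replace ((d - 1) * / (4 * d * x)) with ((d - 1) * x / ((2 * x) * (2 * (d * x))))
        by (field; lra).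
      apply Rmult_le_compat_l; [nra|].
      apply Rinv_le_contravar; [nra|].
      apply Rmult_le_compat; nra. }
    apply Rle_trans with ((1 + il) * / x).
    + apply Rabs_le; split; nra.
    + apply Rle_trans with (4 * (d + 1) * (1 + il) * ((d - 1) * / (4 * d * x))).
      * replace (4 * (d + 1) * (1 + il) * ((d - 1) * / (4 * d * x)))
          with ((d + 1) * (d - 1) * / d * ((1 + il) * / x)) by (field; lra).
        assert (0 <= (1 + il) * / x) by (apply Rmult_le_pos; lra).
        assert (1 <= (d + 1) * (d - 1) * / d).
        { apply (Rmult_le_reg_r d); [lra|].
          rewrite Rmult_assoc, Rinv_l by lra; nra. }
        nra.
      * apply Rmult_le_compat_l; [|exact hg].
        repeat apply Rmult_le_pos; lra.
Qed.

Lemma queue_potential_pos (d x : R) : 2 <= d -> 0 < x -> 0 <= queue_potential d x.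
Proof.
  intros hd hx; assert (hld := ln_gt_0 d ltac:(lra)).
  assert (0 < / x) by (apply Rinv_0_lt_compat; lra).
  apply Rdiv_le_0_compat; [|lra].
  rewrite <- ln_1; apply ln_le; lra.
Qed.

Lemma queue_potential_lim (d x : R) :
  2 <= d -> 0 < x -> is_lim_seq (fun n => queue_potential d (d ^ n * x)) 0.
Proof.
  intros hd hx; assert (hld := ln_gt_0 d ltac:(lra)).
  apply (is_lim_seq_le_le (fun _ => 0) _ (fun n => (/ d) ^ n * (/ x * / ln d))).
  - intros n.
    assert (0 < d ^ n) by (apply pow_lt; lra).
    assert (0 < d ^ n * x) by nra.
    split; [apply queue_potential_pos; assumption|].
    unfold queue_potential, Rdiv; rewrite <- Rmult_assoc.
    apply Rmult_le_compat_r; [left; apply Rinv_0_lt_compat, hld|].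
    assert (0 < / (d ^ n * x)) by (apply Rinv_0_lt_compat; assumption).
    rewrite pow_inv, <- Rinv_mult.
    assert (H' := ln_le_minus_1 (1 + / (d ^ n * x)) ltac:(lra)); lra.
  - apply is_lim_seq_const.
  - replace (Finite 0) with (Rbar_mult 0 (/ x * / ln d)) by (simpl; f_equal; ring).
    apply is_lim_seq_scal_r, is_lim_seq_geom.
    rewrite Rabs_pos_eq by (left; apply Rinv_0_lt_compat; lra).
    rewrite <- Rinv_1; apply Rinv_lt_contravar; lra.
Qed.

(** Summing the drop bounds along [d^n x] telescopes both the potential and the error, so the total
    error is bounded uniformly in [x]. *)
Lemma double_exponential_series (d x : R) :
  2 <= d -> 0 < x ->
  exists s : R, is_series (fun n => exp (- (d ^ n * x))) s /\
    Rabs (s - queue_potential d x) <= 4 * (d + 1) * (1 + / ln d).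
Proof.
  intros hd hx; assert (hld := ln_gt_0 d ltac:(lra)).
  set (K := 4 * (d + 1) * (1 + / ln d)).
  assert (hK : 0 <= K).
  { assert (0 < / ln d) by (apply Rinv_0_lt_compat, hld).
    unfold K; repeat apply Rmult_le_pos; lra. }
  set (a := fun n => exp (- (d ^ n * x))).
  assert (hpos : forall n, 0 < d ^ n * x).
  { intros n; apply Rmult_lt_0_compat; [apply pow_lt|]; lra. }
  assert (part : forall n,
    Rabs (sum_n a n - (queue_potential d x - queue_potential d (d ^ S n * x)))
      <= potential_error d x - potential_error d (d ^ S n * x)).
  { induction n as [|n IH].
    - rewrite sum_O; unfold a; simpl pow; rewrite Rmult_1_l, Rmult_1_r.
      apply queue_potential_drop; assumption.
    - rewrite sum_Sn; change plus with Rplus.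
      assert (H := queue_potential_drop d (d ^ S n * x) hd (hpos _)).
      replace (d * (d ^ S n * x)) with (d ^ S (S n) * x) in H by (simpl; ring).
      unfold a at 2.
      apply Rabs_le_between in IH; apply Rabs_le_between in H; apply Rabs_le; lra. }
  assert (err : forall y, 0 < y -> 0 <= potential_error d y <= K).
  { intros y hy; unfold potential_error; fold K.
    assert (0 < / (1 + y)) by (apply Rinv_0_lt_compat; lra).
    assert (/ (1 + y) <= 1) by (rewrite <- Rinv_1; apply Rinv_le_contravar; lra).
    split; nra. }
  assert (part' : forall n, queue_potential d x - queue_potential d (d ^ S n * x) - K
    <= sum_n a n <= queue_potential d x + K).
  { intros n; specialize (part n); apply Rabs_le_between in part.
    assert (H1 := err x hx); assert (H2 := err _ (hpos (S n))).
    assert (H3 := queue_potential_pos d _ hd (hpos (S n))); lra. }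
  destruct (ex_finite_lim_seq_incr (sum_n a) (queue_potential d x + K)) as [s hs].
  - intros n; rewrite sum_Sn; change plus with Rplus.
    assert (H := exp_pos (- (d ^ S n * x))); unfold a at 3; lra.
  - intros n; apply part'.
  - exists s; split; [exact hs|].
    assert (lo : Rbar_le (queue_potential d x - 0 - K) s).
    { apply (is_lim_seq_le
        (fun n => queue_potential d x - queue_potential d (d ^ S n * x) - K) (sum_n a));
        [apply part'| |exact hs].
      apply is_lim_seq_minus'; [|apply is_lim_seq_const].
      apply is_lim_seq_minus'; [apply is_lim_seq_const|].
      apply (is_lim_seq_incr_1 (fun n => queue_potential d (d ^ n * x))).
      apply queue_potential_lim; assumption. }
    assert (up : Rbar_le s (queue_potential d x + K)).
    { apply (is_lim_seq_le (sum_n a) (fun _ => queue_potential d x + K));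
        [apply part'|exact hs|apply is_lim_seq_const]. }
    simpl in lo, up; apply Rabs_le; lra.
Qed.

(** * Heavy-traffic limits *)

Lemma SQ_equilibrium_ratio (d A : nat) (lam pi0 : R) (u : nat -> R) :
  (1 <= d)%nat -> 0 < lam < 1 -> SQ_ISM_equilibrium d A lam pi0 u ->
  0 < 1 - pi0 * lam ^ d < 1 /\ (1 - pi0 * lam ^ d) ^ S A = 1 - lam ^ d.
Proof.
  intros hd hlam [hpi _ h1 hrec hmem].
  assert (h2 := hrec 1%nat (le_n 1)); simpl in h2.
  rewrite h2, h1 in hmem.
  apply ISM_memory_ratio; assumption.
Qed.

Lemma LL_equilibrium_ratio (d A : nat) (lam pi0 : R) (F : R -> R) :
  (1 <= d)%nat -> 0 < lam < 1 -> LL_ISM_equilibrium d A lam pi0 F ->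
  0 < 1 - pi0 * lam ^ d < 1 /\ (1 - pi0 * lam ^ d) ^ S A = 1 - lam ^ d.
Proof.
  intros hd hlam [hpi _ h0 hode [kappa [hk hmem]]].
  assert (E := is_derive_nonneg_unique F 0 _ _ (Rle_refl 0) hk (hode 0 (Rle_refl 0))).
  rewrite h0 in E.
  replace kappa with (lam - lam * pi0 * lam ^ d) in hmem by lra.
  apply ISM_memory_ratio; assumption.
Qed.

(** * Mean response time of LL(d) *)

Lemma LL_mean_bounds (d A : nat) (lam pi0 : R) (F : R -> R) :
  (2 <= d)%nat -> 0 < lam < 1 -> LL_ISM_equilibrium d A lam pi0 F ->
  LL_mean_finite d F /\
  Rabs (LL_mean_response d pi0 F
        - / (lam * (INR d - 1)) * - ln (1 - pi0 * lam ^ d)) <= 1.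
Proof.
  intros hd hlam heq.
  assert (hr := LL_equilibrium_ratio d A lam pi0 F ltac:(lia) hlam heq).
  destruct heq as [hpi [hrange [_ [hright hlim]]] h0 hode _].
  assert (hd' := d_minus_1_ge_1 d hd).
  assert (hq : 0 < lam * pi0 < 1) by nra.
  destruct (workload_integral d (lam * pi0) F) as [l [hl bounds]]; try assumption.
  - apply hright; lra.
  - intros w hw; apply is_derive_nonneg_interior; [exact hw|apply hode; lra].
  - split; [exists l; exact hl|].
    unfold LL_mean_response; rewrite (is_RInt_gen_unique _ _ hl).
    unfold workload_potential in bounds; rewrite h0 in bounds.
    (* At workload 0 the argument of the logarithm in the potential is exactly the memory ratio. *)
    replace (lam * pi0 * lam ^ (d - 1)) with (pi0 * lam ^ d) in bounds
      by (replace d with (S (d - 1)) at 1 by lia; simpl; ring).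
    set (L := - ln (1 - pi0 * lam ^ d)) in *.
    replace (/ (lam * (INR d - 1)) * L) with (pi0 * (L / (lam * pi0 * (INR d - 1))))
      by (field; repeat split; lra).
    (* The service time 1 and the deficit of at most [pi0 * lam <= 1] have opposite signs, so the
       error stays within 1. *)
    apply Rabs_le; nra.
Qed.

Lemma LL_limit (d A : nat) (pi0 : R -> R) (F : R -> R -> R) :
  (2 <= d)%nat ->
  (forall lam, 0 < lam < 1 -> LL_ISM_equilibrium d A lam (pi0 lam) (F lam)) ->
  filterlim
    (fun lam => - (LL_mean_response d (pi0 lam) (F lam) / ln (1 - lam)))
    (at_left 1)
    (locally (1 / (INR A + 1) * (1 / (INR d - 1)))).
Proof.
  intros hd heq; assert (hd' := d_minus_1_ge_1 d hd).
  apply (mean_over_log_limit d A (fun lam => 1 - pi0 lam * lam ^ d)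
    (fun lam => / (lam * (INR d - 1))) _ _ 1); [lia| | |].
  - intros lam hlam.
    destruct (LL_equilibrium_ratio d A lam _ _ ltac:(lia) hlam (heq lam hlam)); tauto.
  - apply (filterlim_filter_le_1 (F := locally 1) (G := at_left 1)
      (fun lam => / (lam * (INR d - 1)))); [apply filter_le_within|].
    replace (1 / (INR d - 1)) with (/ (1 * (INR d - 1))) by (field; lra).
    apply (ex_derive_continuous (fun lam => / (lam * (INR d - 1)))).
    auto_derive; lra.
  - generalize (at_left_1_interval 0 Rlt_0_1); apply filter_imp; intros lam hlam.
    apply (LL_mean_bounds d A); auto.
Qed.

(** * Mean response time of SQ(d) *)

Lemma exp_INR_mult (n : nat) (x : R) : exp (INR n * x) = exp x ^ n.
Proof.
  induction n as [|n IH]; [simpl; rewrite Rmult_0_l; apply exp_0|].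
  rewrite S_INR, Rmult_plus_distr_r, exp_plus, IH, Rmult_1_l; simpl; ring.
Qed.

(** For [v_k = ln (u_k / lam)] the recursion reads [v_(k+1) = d v_k - (d - 1) delta]. Its fixed
    point is [delta], and each step multiplies [v - delta] by [d], starting from [v_1 = 0]. *)
Lemma SQ_tail_closed_form (d : nat) (lam pi0 delta : R) (u : nat -> R) :
  (1 <= d)%nat -> u 1%nat = lam ->
  (forall k, (1 <= k)%nat -> u (k + 1)%nat = lam * pi0 * u k ^ d) ->
  exp (- (INR d - 1) * delta) = pi0 * lam ^ d ->
  forall k, u (k + 1)%nat = lam * exp (delta - INR d ^ k * delta).
Proof.
  intros hd h1 hrec hdelta.
  induction k as [|k IH].
  - simpl; rewrite h1; replace (delta - 1 * delta) with 0 by ring.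
    rewrite exp_0; ring.
  - replace (S k + 1)%nat with (k + 1 + 1)%nat by lia.
    rewrite hrec, IH, Rpow_mult_distr, <- exp_INR_mult by lia.
    replace (lam * pi0 * (lam ^ d * exp (INR d * (delta - INR d ^ k * delta))))
      with (lam * (pi0 * lam ^ d * exp (INR d * (delta - INR d ^ k * delta)))) by ring.
    rewrite <- hdelta, <- exp_plus; do 2 f_equal; simpl; ring.
Qed.

Definition log_scale (d : nat) (r : R) : R := - ln (1 - r) / (INR d - 1).

(** Both parts rest on [r <= - ln (1 - r) <= 1 / (1 - r) - 1 <= 2 r]; for the second, [d - 1 >= 1]
    gives [exp (log_scale d r) <= 1 / (1 - r)]. *)
Lemma log_scale_bounds (d : nat) (r : R) :
  (2 <= d)%nat -> 0 < r <= 1 / 2 ->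
  r <= (INR d - 1) * log_scale d r <= 2 * r /\ exp (log_scale d r) <= 2.
Proof.
  intros hd hr; assert (hd' := d_minus_1_ge_1 d hd).
  assert (E : (INR d - 1) * log_scale d r = - ln (1 - r))
    by (unfold log_scale; field; lra).
  assert (lo := ln_le_minus_1 (1 - r) ltac:(lra)).
  assert (hinv : 0 < / (1 - r)) by (apply Rinv_0_lt_compat; lra).
  assert (up := ln_le_minus_1 _ hinv).
  rewrite ln_Rinv in up by lra.
  assert (/ (1 - r) <= 1 + 2 * r).
  { apply (Rmult_le_reg_r (1 - r)); [lra|]; rewrite Rinv_l by lra; nra. }
  repeat split; [lra|lra|].
  assert (0 < log_scale d r) by nra.
  apply Rle_trans with (exp (ln (/ (1 - r)))); [|rewrite exp_ln; lra].
  rewrite ln_Rinv by lra.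
  assert (h : log_scale d r <= - ln (1 - r)) by nra.
  destruct h as [h| ->]; [left; apply exp_increasing, h|right; reflexivity].
Qed.

(** The difference equals [ln s / ln d] with [s = r (1 + 1 / (d x))]. From [r <= (d - 1) x <= 2 r]
    and [d <= 2 (d - 1)] follows [1/4 <= s <= 2], and [- ln s <= 1 / s - 1 <= 3]. *)
Lemma queue_potential_log_scale (d : nat) (r : R) :
  (2 <= d)%nat -> 0 < r <= 1 / 2 ->
  Rabs (queue_potential (INR d) (INR d * log_scale d r) - - ln r / ln (INR d))
    <= 3 / ln (INR d).
Proof.
  intros hd hr; assert (hd' := d_minus_1_ge_1 d hd).
  assert (hld := ln_gt_0 (INR d) ltac:(lra)).
  destruct (log_scale_bounds d r hd hr) as [[lo up] _].
  set (x := log_scale d r) in *; set (D := INR d) in *.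
  assert (hx : 0 < x) by nra.
  assert (hDx : 0 < D * x) by nra.
  assert (hi : 0 < / (D * x)) by (apply Rinv_0_lt_compat; lra).
  assert (b1 : r * / (D * x) <= 1).
  { apply (Rmult_le_reg_r (D * x)); [lra|].
    rewrite Rmult_assoc, Rinv_l by lra; lra. }
  assert (b2 : 1 / 4 <= r * / (D * x)).
  { apply (Rmult_le_reg_r (D * x)); [lra|].
    rewrite Rmult_assoc, Rinv_l by lra; nra. }
  set (s := r * (1 + / (D * x))).
  assert (hs : 1 / 4 <= s <= 2) by (unfold s; lra).
  assert (E : queue_potential D (D * x) - - ln r / ln D = ln s / ln D).
  { unfold queue_potential, s; rewrite ln_mult by lra; field; lra. }
  assert (l1 := ln_le_minus_1 s ltac:(lra)).
  assert (hsi : / s <= 4).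
  { replace 4 with (/ (1 / 4)) by field; apply Rinv_le_contravar; lra. }
  assert (l2 := ln_le_minus_1 (/ s) (Rinv_0_lt_compat s ltac:(lra))).
  rewrite ln_Rinv in l2 by lra.
  rewrite E; unfold Rdiv; rewrite Rabs_mult, (Rabs_pos_eq (/ ln D))
    by (left; apply Rinv_0_lt_compat, hld).
  apply Rmult_le_compat_r; [left; apply Rinv_0_lt_compat, hld|].
  apply Rabs_le; lra.
Qed.

Lemma SQ_mean_formula (d A : nat) (lam pi0 : R) (u : nat -> R) :
  (2 <= d)%nat -> 0 < lam < 1 -> SQ_ISM_equilibrium d A lam pi0 u ->
  SQ_mean_finite d u /\
  exists s : R,
    SQ_mean_response d pi0 u = 1 + exp (log_scale d (1 - pi0 * lam ^ d)) * s /\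
    Rabs (s - queue_potential (INR d) (INR d * log_scale d (1 - pi0 * lam ^ d)))
      <= 4 * (INR d + 1) * (1 + / ln (INR d)).
Proof.
  intros hd hlam heq; assert (hd' := d_minus_1_ge_1 d hd).
  destruct (SQ_equilibrium_ratio d A lam pi0 u ltac:(lia) hlam heq) as [hr _].
  destruct heq as [hpi _ h1 hrec _].
  set (r := 1 - pi0 * lam ^ d) in *; set (x := log_scale d r).
  assert (hx : 0 < x).
  { apply Rdiv_lt_0_compat; [|lra].
    assert (H : ln (1 - r) < ln 1) by (apply ln_increasing; lra).
    rewrite ln_1 in H; lra. }
  assert (ex : exp (- (INR d - 1) * x) = pi0 * lam ^ d).
  { replace (- (INR d - 1) * x) with (ln (1 - r))
      by (unfold x, log_scale; field; lra).
    rewrite exp_ln by lra; unfold r; ring. }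
  assert (cf := SQ_tail_closed_form d lam pi0 x u ltac:(lia) h1 hrec ex).
  destruct (double_exponential_series (INR d) (INR d * x)) as [s [hs bs]];
    [lra|nra|].
  assert (hser : is_series (fun k => u (k + 1)%nat ^ d) (exp x / pi0 * s)).
  { apply (is_series_ext (fun k => exp x / pi0 * exp (- (INR d ^ k * (INR d * x))))).
    (* The recursion gives [u_(k+1)^d] as [u_(k+2) / (lam pi0)]; this index shift is why the double
       exponentials start at [INR d * x]. *)
    - intros k; apply (Rmult_eq_reg_l (lam * pi0)); [|apply Rgt_not_eq; nra].
      rewrite <- hrec by lia.
      replace (k + 1 + 1)%nat with (S k + 1)%nat by lia; rewrite (cf (S k)).
      replace (x - INR d ^ S k * x) with (x + - (INR d ^ k * (INR d * x)))
        by (simpl; ring).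
      rewrite exp_plus; field; lra.
    - exact (is_series_scal_l (V := R_NormedModule) (exp x / pi0) _ s hs). }
  split; [exists (exp x / pi0 * s); exact hser|].
  exists s; split; [|exact bs].
  unfold SQ_mean_response; rewrite (is_series_unique _ _ hser); field; lra.
Qed.

Lemma SQ_limit (d A : nat) (pi0 : R -> R) (u : R -> nat -> R) :
  (2 <= d)%nat ->
  (forall lam, 0 < lam < 1 -> SQ_ISM_equilibrium d A lam (pi0 lam) (u lam)) ->
  filterlim
    (fun lam => - (SQ_mean_response d (pi0 lam) (u lam) / ln (1 - lam)))
    (at_left 1)
    (locally (1 / (INR A + 1) * (1 / ln (INR d)))).
Proof.
  intros hd heq; assert (hd' := d_minus_1_ge_1 d hd).
  assert (hld := ln_gt_0 (INR d) ltac:(lra)).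
  set (r := fun lam => 1 - pi0 lam * lam ^ d).
  assert (hr : forall lam, 0 < lam < 1 -> 0 < r lam /\ r lam ^ S A = 1 - lam ^ d).
  { intros lam hlam.
    destruct (SQ_equilibrium_ratio d A lam _ _ ltac:(lia) hlam (heq lam hlam)).
    unfold r; tauto. }
  assert (r0 := ratio_tends_to_0 d A r ltac:(lia) hr).
  set (K := 4 * (INR d + 1) * (1 + / ln (INR d))).
  (* The error constant collects the service time 1 and, times the bound 2 on [exp (log_scale d r)],
     the series error [K] and the error [3 / ln d] from replacing the potential by
     [- ln r / ln d]. *)
  apply (mean_over_log_limit d A r
    (fun lam => exp (log_scale d (r lam)) / ln (INR d)) _ _
    (1 + 2 * (K + 3 / ln (INR d)))); [lia|exact hr| |].
  - apply (filterlim_comp _ _ _ r (fun x => exp (log_scale d x) / ln (INR d)) _ _ _ r0).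
    replace (1 / ln (INR d)) with (exp (log_scale d 0) / ln (INR d)).
    + apply (ex_derive_continuous (fun x => exp (log_scale d x) / ln (INR d))).
      unfold log_scale; auto_derive; lra.
    + unfold log_scale; rewrite Rminus_0_r, ln_1.
      replace (- 0 / (INR d - 1)) with 0 by (field; lra).
      rewrite exp_0; reflexivity.
  (* The bounds on [log_scale] require [r <= 1 / 2], which holds near [lam = 1]. *)
  - assert (rsmall := proj1 (filterlim_locally _ _) r0 (mkposreal (1 / 2) ltac:(lra))).
    generalize (filter_and _ _ (at_left_1_interval 0 Rlt_0_1) rsmall).
    apply filter_imp; intros lam [hlam hb].
    change (Rabs (r lam - 0) < 1 / 2) in hb.
    destruct (hr lam hlam) as [hr0 _].
    rewrite Rminus_0_r, Rabs_pos_eq in hb by lra.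
    destruct (SQ_mean_formula d A lam _ _ hd hlam (heq lam hlam)) as [_ [s [-> hs]]].
    change (1 - pi0 lam * lam ^ d) with (r lam) in *; fold K in hs.
    assert (hp := queue_potential_log_scale d (r lam) hd ltac:(lra)).
    destruct (log_scale_bounds d (r lam) hd ltac:(lra)) as [_ he].
    assert (he0 := exp_pos (log_scale d (r lam))).
    set (e := exp (log_scale d (r lam))) in *.
    set (psi := queue_potential (INR d) (INR d * log_scale d (r lam))) in *.
    set (L := - ln (r lam)) in *.
    replace (1 + e * s - e / ln (INR d) * L)
      with (1 + e * ((s - psi) + (psi - L / ln (INR d)))) by (field; lra).
    eapply Rle_trans; [apply Rabs_triang|].
    rewrite Rabs_R1, Rabs_mult, (Rabs_pos_eq e) by lra.
    apply Rplus_le_compat_l, Rmult_le_compat; [lra|apply Rabs_pos|exact he|].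
    eapply Rle_trans; [apply Rabs_triang|]; lra.
Qed.

Theorem theorem8 (d A : nat) (hd : (2 <= d)%nat) (hA : (1 <= A)%nat) :
  (forall (pi0 : R -> R) (u : R -> nat -> R),
     (forall lam, 0 < lam < 1 -> SQ_ISM_equilibrium d A lam (pi0 lam) (u lam)) ->
     (forall lam, 0 < lam < 1 -> SQ_mean_finite d (u lam)) /\
     filterlim
       (fun lam => - (SQ_mean_response d (pi0 lam) (u lam) / ln (1 - lam)))
       (at_left 1)
       (locally (1 / (INR A + 1) * (1 / ln (INR d)))))
  /\
  (forall (pi0 : R -> R) (F : R -> R -> R),
     (forall lam, 0 < lam < 1 -> LL_ISM_equilibrium d A lam (pi0 lam) (F lam)) ->
     (forall lam, 0 < lam < 1 -> LL_mean_finite d (F lam)) /\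
     filterlim
       (fun lam => - (LL_mean_response d (pi0 lam) (F lam) / ln (1 - lam)))
       (at_left 1)
       (locally (1 / (INR A + 1) * (1 / (INR d - 1))))).
Proof.
  split; intros pi0 u heq; split.
  - intros lam hlam; apply (SQ_mean_formula d A lam (pi0 lam)); auto.
  - apply SQ_limit; assumption.
  - intros lam hlam; apply (LL_mean_bounds d A lam (pi0 lam)); auto.
  - apply LL_limit; assumption.
Qed.
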